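(* Let $\mathbb{F}_q$ be a finite field of odd characteristic and let $\epsilon,\delta\in\mathbb{F}_q$ with $\epsilon(\delta^2-\epsilon)\neq 0$ and $\chi(\epsilon)=1$. Fix a square root $\sqrt{\epsilon}\in\mathbb{F}_q$. Then the Jacobi quartic curve $J_{\epsilon,\delta}: y^2=\epsilon x^4+2\delta x^2+1$ over $\mathbb{F}_q$ has dADD-M formulas with the function $$w(x,y)=4\sqrt{\epsilon}\,\frac{x^2y^2}{(1-\epsilon x^4)^2}$$ and $e=\dfrac{2(\sqrt{\epsilon}-\delta)}{\sqrt{\epsilon}}$; that is, $w$ is an inverted Montgomery-like function on $J_{\epsilon,\delta}$ with parameter $e$.
   Context: $\chi$ is the quadratic character of $\mathbb{F}_q$: for $a\ne0$, $\chi(a)=1$ if $a$ is a square in $\mathbb{F}_q$ and $\chi(a)=-1$ otherwise. The Jacobi quartic curve $J_{\epsilon,\delta}$ is regarded as an elliptic curve through its smooth projective model $X^2=TZ$, $Y^2=\epsilon T^2+2\delta X^2+Z^2$ in $\mathbb{P}^3$ with coordinates $(X:Y:T:Z)$, the affine point $(x,y)$ being $(x:y:x^2:1)$; the points with $Z=0$ are $(0:\pm\sqrt{\epsilon}:1:0)$. The identity is $(0,1)$, $-(x,y)=(-x,y)$, and addition is generically $$(x_1,y_1)+(x_2,y_2)=\left(\frac{x_1y_2+x_2y_1}{1-\epsilon x_1^2x_2^2},\ \frac{(y_1y_2+2\delta x_1x_2)(1+\epsilon x_1^2x_2^2)+2\epsilon x_1x_2(x_1^2+x_2^2)}{(1-\epsilon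 x_1^2x_2^2)^2}\right).$$ Inverted Montgomery-like function: let $E$ be an elliptic curve over a field $\mathbb{F}$ of characteristic $\neq2$ and $w$ a rational function on $E$ with $w(P)=w(-P)$ for all $P$. View $w(P)$ in $\mathbb{P}^1(\mathbb{F})$ as $(w(P):1)$ if $w$ is regular at $P$ and $(1:0)$ otherwise. For $P_1,P_2\in E(\mathbb{F})$ put $(W_0:Z_0)=w(P_2-P_1)$, $(W_1:Z_1)=w(P_1)$, $(W_2:Z_2)=w(P_2)$, $(W_3:Z_3)=w(P_1+P_2)$, $(W_4:Z_4)=w(2P_1)$. Then $w$ is an inverted Montgomery-like function with parameter $e\in\mathbb{F}$ if for all $P_1,P_2\in E(\mathbb{F})$ with $W_0Z_0\neq0$, $$(W_4:Z_4)=\big(4W_1Z_1((W_1+Z_1)^2-eW_1Z_1):(W_1^2-Z_1^2)^2\big),$$ $$(W_3:Z_3)=\big(Z_0(W_1Z_2-W_2Z_1)^2:W_0(W_1W_2-Z_1Z_2)^2\big).$$ (Equivalently $1/w$ is a Montgomery-like function, given by the same formulas with the two coordinates swapped; a curve with such a function is said to have dADD-M formulas.) *)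

(* Defs.v *)
From mathcomp Require Import all_boot all_order all_algebra.
From mathcomp.multinomials Require Import mpoly.
From mathcomp Require Import ring.

Set Implicit Arguments.
Unset Strict Implicit.
Unset Printing Implicit Defensive.

Import GRing.Theory.
Local Open Scope ring_scope.

Definition quad_char (F : finFieldType) (a : F) : int :=
  if a == 0 then 0 else if [exists b : F, b ^+ 2 == a] then 1 else -1.

(** Homogeneous coordinates [(X : Y : T : Z)].  Points are handled through
    representatives; [peq4] and [peq2] are equality in [P^3] and in [P^1], and
    they also require both sides to be nonzero. *)

Record quad (K : Type) := Quad { qX : K; qY : K; qT : K; qZ : K }.

Definition qcoord (K : Type) (P : quad K) : 'I_4 -> K :=
  tnth [tuple qX P; qY P; qT P; qZ P].

Definition qnonzero (K : fieldType) (P : quad K) : bool :=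
  [|| qX P != 0, qY P != 0, qT P != 0 | qZ P != 0].

Definition peq4 (K : fieldType) (P Q : quad K) : Prop :=
  qnonzero P /\ qnonzero Q /\
  forall i j, qcoord P i * qcoord Q j = qcoord P j * qcoord Q i.

Definition peq2 (K : fieldType) (W Z W' Z' : K) : Prop :=
  [/\ (W != 0) || (Z != 0), (W' != 0) || (Z' != 0) & W * Z' = W' * Z].

(** The smooth model [X^2 = TZ, Y^2 = eps T^2 + 2 delta X^2 + Z^2]; the affine
    point [(x, y)] is [(x : y : x^2 : 1)]. *)

Definition on_J (K : fieldType) (eps delta : K) (P : quad K) : bool :=
  [&& qnonzero P, qX P ^+ 2 == qT P * qZ P
    & qY P ^+ 2 == eps * qT P ^+ 2 + 2 * delta * qX P ^+ 2 + qZ P ^+ 2].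

Definition jaff (K : fieldType) (x y : K) : quad K := Quad x y (x ^+ 2) 1.

Definition jzero (K : fieldType) : quad K := jaff 0 1.

Definition jopp (K : fieldType) (P : quad K) : quad K :=
  Quad (- qX P) (qY P) (qT P) (qZ P).

(** [jlaw1] is the affine addition formula with denominators cleared, using
    [x_i^2 = T_i / Z_i].  [jlaw2] is another expression of the same rational
    map ([jlaw_agree]), and [jadd] falls back on it where [jlaw1] is undefined.
    The two together cover all pairs of points ([jadd_nonzero]), so [jadd] is the
    morphism extending the affine formula. *)

Definition jlaw1 (K : fieldType) (eps delta : K) (P Q : quad K) : quad K :=
  let: Quad X1 Y1 T1 Z1 := P in
  let: Quad X2 Y2 T2 Z2 := Q in
  let A := X1 * Y2 + X2 * Y1 in
  let D := Z1 * Z2 - eps * T1 * T2 in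
  Quad (A * D)
       ((Y1 * Y2 + 2 * delta * X1 * X2) * (Z1 * Z2 + eps * T1 * T2)
          + 2 * eps * X1 * X2 * (T1 * Z2 + T2 * Z1))
       (A ^+ 2) (D ^+ 2).

Definition jlaw2 (K : fieldType) (eps delta : K) (P Q : quad K) : quad K :=
  let: Quad X1 Y1 T1 Z1 := P in
  let: Quad X2 Y2 T2 Z2 := Q in
  let B := X1 * Y2 - X2 * Y1 in
  let C := T1 * Z2 - T2 * Z1 in
  Quad (C * B)
       ((Y1 * Y2 - 2 * delta * X1 * X2) * (T1 * Z2 + T2 * Z1)
          - 2 * X1 * X2 * (Z1 * Z2 + eps * T1 * T2))
       (C ^+ 2) (B ^+ 2).

Definition jadd (K : fieldType) (eps delta : K) (P Q : quad K) : quad K :=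
  if qnonzero (jlaw1 eps delta P Q) then jlaw1 eps delta P Q
  else jlaw2 eps delta P Q.

Lemma ord4P (p : 'I_4 -> Prop) :
  p ord0 -> p (@Ordinal 4 1 isT) -> p (@Ordinal 4 2 isT) ->
  p (@Ordinal 4 3 isT) -> forall i, p i.
Proof.
move=> p0 p1 p2 p3 [[|[|[|[|//]]]] hi].
- by rewrite (_ : Ordinal hi = ord0) //; apply: val_inj.
- by rewrite (_ : Ordinal hi = @Ordinal 4 1 isT) //; apply: val_inj.
- by rewrite (_ : Ordinal hi = @Ordinal 4 2 isT) //; apply: val_inj.
- by rewrite (_ : Ordinal hi = @Ordinal 4 3 isT) //; apply: val_inj.
Qed.

Lemma jlaw_agree (K : fieldType) (eps delta : K) (P Q : quad K) :
  on_J eps delta P -> on_J eps delta Q ->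
  forall i j, qcoord (jlaw1 eps delta P Q) i * qcoord (jlaw2 eps delta P Q) j =
              qcoord (jlaw1 eps delta P Q) j * qcoord (jlaw2 eps delta P Q) i.
Proof.
case: P Q => [X1 Y1 T1 Z1] [X2 Y2 T2 Z2].
move=> /and3P[_ /eqP/= hX1 /eqP/= hY1] /and3P[_ /eqP/= hX2 /eqP/= hY2].
rewrite hX1 in hY1; rewrite hX2 in hY2.
by apply: ord4P; apply: ord4P; rewrite /qcoord /tnth //=; ring: hX1 hY1 hX2 hY2.
Qed.

Lemma jlaw1_on_J (K : fieldType) (eps delta : K) (P Q : quad K) :
  on_J eps delta P -> on_J eps delta Q -> qnonzero (jlaw1 eps delta P Q) ->
  on_J eps delta (jlaw1 eps delta P Q).
Proof.
case: P Q => [X1 Y1 T1 Z1] [X2 Y2 T2 Z2].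
move=> /and3P[_ /eqP/= hX1 /eqP/= hY1] /and3P[_ /eqP/= hX2 /eqP/= hY2] nz.
rewrite hX1 in hY1; rewrite hX2 in hY2.
by apply/and3P; split => //=; apply/eqP; ring: hX1 hY1 hX2 hY2.
Qed.

Lemma jlaw2_on_J (K : fieldType) (eps delta : K) (P Q : quad K) :
  on_J eps delta P -> on_J eps delta Q -> qnonzero (jlaw2 eps delta P Q) ->
  on_J eps delta (jlaw2 eps delta P Q).
Proof.
case: P Q => [X1 Y1 T1 Z1] [X2 Y2 T2 Z2].
move=> /and3P[_ /eqP/= hX1 /eqP/= hY1] /and3P[_ /eqP/= hX2 /eqP/= hY2] nz.
rewrite hX1 in hY1; rewrite hX2 in hY2.
by apply/and3P; split => //=; apply/eqP; ring: hX1 hY1 hX2 hY2.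
Qed.

Lemma on_J_TZ (K : fieldType) (eps delta : K) (P : quad K) :
  on_J eps delta P -> qT P = 0 -> qZ P = 0 -> False.
Proof.
case: P => [X Y T Z] /and3P[/= nz /eqP hX /eqP hY] /= T0 Z0; subst T Z.
have X0 : X = 0 by apply/eqP; rewrite -sqrf_eq0 hX mul0r.
have Y0 : Y = 0 by apply/eqP; rewrite -sqrf_eq0 hY X0 !expr0n /= !mulr0 !addr0.
by move: nz; rewrite /qnonzero /= X0 Y0 eqxx.
Qed.

Lemma jadd_nonzero (K : fieldType) (eps delta : K) (P Q : quad K) :
  (2 : K) != 0 -> eps * (delta ^+ 2 - eps) != 0 ->
  on_J eps delta P -> on_J eps delta Q -> qnonzero (jadd eps delta P Q).
Proof.
move=> nz2 nzd PJ QJ; rewrite /jadd; case: ifPn => // nz1.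
apply/negPn/negP => nz2'; move: nz1 nz2'.
have PTZ := on_J_TZ PJ; have QTZ := on_J_TZ QJ.
case: P Q PJ QJ PTZ QTZ => [X1 Y1 T1 Z1] [X2 Y2 T2 Z2].
move=> /and3P[_ /eqP/= hX1 /eqP/= hY1] /and3P[_ /eqP/= hX2 /eqP/= hY2].
move=> /= PTZ QTZ.
rewrite /qnonzero /= !negb_or !negbK !sqrf_eq0.
move=> /and4P[_ _ /eqP hA /eqP hD] /and4P[_ _ /eqP hC /eqP hB].
have XY1 : X1 * Y2 = 0.
  apply/eqP; rewrite -(mulrI_eq0 _ (mulfI nz2)); apply/eqP.
  have -> : 2 * (X1 * Y2) = (X1 * Y2 + X2 * Y1) + (X1 * Y2 - X2 * Y1) by ring.
  by rewrite hA hB addr0.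
have XY2 : X2 * Y1 = 0.
  apply/eqP; rewrite -(mulrI_eq0 _ (mulfI nz2)); apply/eqP.
  have -> : 2 * (X2 * Y1) = (X1 * Y2 + X2 * Y1) - (X1 * Y2 - X2 * Y1) by ring.
  by rewrite hA hB subr0.
move/eqP: hC; rewrite subr_eq0 => /eqP hC.
move/eqP: hD; rewrite subr_eq0 => /eqP hD.
have Q0 : forall a, a != 0 -> a * T2 = 0 -> a * Z2 = 0 -> False.
  move=> a a0 /eqP + /eqP; rewrite !mulf_eq0 (negPf a0) /=.
  by move=> /eqP + /eqP; apply: QTZ.
have e0 : eps != 0 by apply: contraNneq nzd => ->; rewrite mul0r.
have aux : T1 * Z1 != 0.
  apply/negP; rewrite mulf_eq0 => /orP[] /eqP h.
    have Z1n : Z1 != 0 by apply/eqP => /(PTZ h).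
    by apply: (Q0 _ Z1n); [rewrite mulrC -hC h mul0r | rewrite hD h mulr0 mul0r].
  have T1n : T1 != 0 by apply/eqP => /PTZ; apply.
  by apply: (Q0 _ (mulf_neq0 e0 T1n)); [rewrite -hD h mul0r | rewrite -mulrA hC h !mulr0].
have X1n : X1 != 0 by rewrite -sqrf_eq0 hX1.
have Y20 : Y2 = 0 by apply/eqP; move/eqP: XY1; rewrite mulf_eq0 (negPf X1n).
have DZ : Z1 ^+ 2 - eps * T1 ^+ 2 = 0.
  apply/eqP/negPn/negP => n.
  apply: (Q0 _ n); first last.
    have -> : (Z1 ^+ 2 - eps * T1 ^+ 2) * Z2 =
      Z1 * (Z1 * Z2 - eps * T1 * T2) - eps * T1 * (T1 * Z2 - T2 * Z1) by ring.
    by rewrite hD hC !subrr !mulr0 subr0.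
  have -> : (Z1 ^+ 2 - eps * T1 ^+ 2) * T2 =
    T1 * (Z1 * Z2 - eps * T1 * T2) - Z1 * (T1 * Z2 - T2 * Z1) by ring.
  by rewrite hD hC !subrr !mulr0 subr0.
have T1n : T1 != 0 by apply: contraNneq aux => ->; rewrite mul0r.
have Z1n : Z1 != 0 by apply: contraNneq aux => ->; rewrite mulr0.
have X2n : X2 != 0.
  apply/eqP => X20; move: hX2; rewrite X20 expr0n /= => /esym/eqP.
  rewrite mulf_eq0 => /orP[] /eqP h.
    by apply: (Q0 _ T1n); [rewrite h mulr0 | rewrite hC h mul0r].
  by apply: (Q0 _ Z1n); [rewrite mulrC -hC h mulr0 | rewrite h mulr0].
have Y10 : Y1 = 0 by apply/eqP; move/eqP: XY2; rewrite mulf_eq0 (negPf X2n).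
have hZ : Z1 + delta * T1 = 0.
  apply/eqP; rewrite -(mulrI_eq0 _ (mulfI (mulf_neq0 nz2 Z1n))); apply/eqP.
  have -> : 2 * Z1 * (Z1 + delta * T1) =
    (eps * T1 ^+ 2 + 2 * delta * (T1 * Z1) + Z1 ^+ 2)
    + (Z1 ^+ 2 - eps * T1 ^+ 2) by ring.
  by rewrite DZ -hX1 -hY1 Y10 expr0n addr0.
move/negP: nzd; apply; rewrite mulf_eq0 (negPf e0) /=.
rewrite -(mulrI_eq0 _ (mulfI (mulf_neq0 T1n T1n))); apply/eqP.
have -> : T1 * T1 * (delta ^+ 2 - eps) =
  (Z1 ^+ 2 - eps * T1 ^+ 2) - (Z1 + delta * T1) * (Z1 - delta * T1) by ring.
by rewrite DZ hZ mul0r subr0.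
Qed.

Lemma jadd_on_J (K : fieldType) (eps delta : K) (P Q : quad K) :
  (2 : K) != 0 -> eps * (delta ^+ 2 - eps) != 0 ->
  on_J eps delta P -> on_J eps delta Q -> on_J eps delta (jadd eps delta P Q).
Proof.
move=> nz2 nzd PJ QJ; have := jadd_nonzero nz2 nzd PJ QJ.
rewrite /jadd; case: ifP => h nz; first exact: jlaw1_on_J.
exact: jlaw2_on_J.
Qed.

Lemma jadd_affine (K : fieldType) (eps delta x1 y1 x2 y2 : K) :
  let d := 1 - eps * x1 ^+ 2 * x2 ^+ 2 in
  d != 0 ->
  let x3 := (x1 * y2 + x2 * y1) / d in
  let y3 := ((y1 * y2 + 2 * delta * x1 * x2) * (1 + eps * x1 ^+ 2 * x2 ^+ 2)
               + 2 * eps * x1 * x2 * (x1 ^+ 2 + x2 ^+ 2)) / d ^+ 2 in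
  peq4 (jadd eps delta (jaff x1 y1) (jaff x2 y2)) (jaff x3 y3).
Proof.
move=> d d0 x3 y3.
have dE : 1 * 1 - eps * x1 ^+ 2 * x2 ^+ 2 = d by rewrite mulr1.
have nz : qnonzero (jlaw1 eps delta (jaff x1 y1) (jaff x2 y2)).
  by rewrite /qnonzero /= dE (expf_neq0 2 d0) !orbT.
split; [by rewrite /jadd nz | split; first by rewrite /qnonzero /= oner_eq0 !orbT].
rewrite /jadd nz /x3 /y3; apply: ord4P; apply: ord4P;
  by rewrite /qcoord /tnth //= ?mulr1 ?mul1r -/d; field.
Qed.

Lemma jadd_zero (K : fieldType) (eps delta : K) (P : quad K) :
  on_J eps delta P -> peq4 (jadd eps delta (jzero K) P) P.
Proof.
move=> PJ; have TZ := on_J_TZ PJ; move: PJ TZ.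
case: P => [X Y T Z] /and3P[/= nz /eqP hX /eqP hY] /= TZ.
rewrite /jadd /jzero /jaff; case: ifPn => nz1.
  split=> //; split=> //.
  by apply: ord4P; apply: ord4P; rewrite /qcoord /tnth //=; ring: hX.
have T0 : T != 0.
  apply: contraNneq nz1 => T0.
  have Zn : Z != 0 by apply/eqP => /(TZ T0).
  by rewrite /qnonzero /= !expr0n /= !mulr0 mul0r mul1r subr0 (expf_neq0 2 Zn) !orbT.
split; first by rewrite /qnonzero /= !expr0n /= mul0r sub0r mulr1 sqrf_eq0 oppr_eq0 T0 !orbT.
split=> //.
by apply: ord4P; apply: ord4P; rewrite /qcoord /tnth //=; ring: hX.
Qed.

Lemma jadd_opp (K : fieldType) (eps delta : K) (P : quad K) :
  (2 : K) != 0 -> eps * (delta ^+ 2 - eps) != 0 ->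
  on_J eps delta P -> peq4 (jadd eps delta P (jopp P)) (jzero K).
Proof.
move=> nz2 nzd PJ.
have NJ : on_J eps delta (jopp P).
  by move: PJ; rewrite /on_J /qnonzero /= sqrrN oppr_eq0.
split; first exact: jadd_nonzero.
split; first by rewrite /qnonzero /= oner_eq0 /= ?orbT.
case: P PJ {NJ} => [X Y T Z] /and3P[/= nz /eqP hX /eqP hY].
rewrite hX in hY.
rewrite /jadd /jopp /=; case: ifP => _.
  by apply: ord4P; apply: ord4P; rewrite /qcoord /tnth //=; ring: hX hY.
by apply: ord4P; apply: ord4P; rewrite /qcoord /tnth //=; ring: hX hY.
Qed.

(** A rational function on [J] is a quotient of forms of the same degree in
    [X, Y, T, Z], modulo the homogeneous ideal of [J]. *)

Definition mX (K : fieldType) : {mpoly K[4]} := 'X_(@Ordinal 4 0 isT).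
Definition mY (K : fieldType) : {mpoly K[4]} := 'X_(@Ordinal 4 1 isT).
Definition mT (K : fieldType) : {mpoly K[4]} := 'X_(@Ordinal 4 2 isT).
Definition mZ (K : fieldType) : {mpoly K[4]} := 'X_(@Ordinal 4 3 isT).

Definition J_ideal (K : fieldType) (eps delta : K) (p : {mpoly K[4]}) : Prop :=
  exists a b : {mpoly K[4]},
    p = a * (mX K ^+ 2 - mT K * mZ K)
        + b * (mY K ^+ 2 - (eps *: mT K ^+ 2 + (2 * delta) *: mX K ^+ 2
                            + mZ K ^+ 2)).

Record frac (K : fieldType) := Frac { fnum : {mpoly K[4]}; fden : {mpoly K[4]} }.

Definition is_ratfun (K : fieldType) (eps delta : K) (f : frac K) : Prop :=
  (exists d : nat, fnum f \is d.-homog /\ fden f \is d.-homog)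
  /\ ~ J_ideal eps delta (fden f).

Definition same_ratfun (K : fieldType) (eps delta : K) (f g : frac K) : Prop :=
  J_ideal eps delta (fnum f * fden g - fnum g * fden f).

Definition regular_at (K : fieldType) (eps delta : K) (f : frac K)
    (P : quad K) (v : K) : Prop :=
  exists g : frac K,
    [/\ is_ratfun eps delta g, same_ratfun eps delta f g,
        (fden g).@[qcoord P] != 0
      & v = (fnum g).@[qcoord P] / (fden g).@[qcoord P]].

(** [(W : Z)] is the value of [f] at [P] in [P^1]. *)
Definition has_value (K : fieldType) (eps delta : K) (f : frac K)
    (P : quad K) (W Z : K) : Prop :=
  (exists v, regular_at eps delta f P v /\ peq2 W Z v 1)
  \/ (~ (exists v, regular_at eps delta f P v) /\ peq2 W Z 1 0).

Definition map_frac (F K : fieldType) (phi : {rmorphism F -> K}) (f : frac F) :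
  frac K := Frac (map_mpoly phi (fnum f)) (map_mpoly phi (fden f)).

(** Evenness is required at all geometric points, that is, at the points of [J]
    over every extension field of [F]. *)
Definition even_on_J (F : fieldType) (eps delta : F) (w : frac F) : Prop :=
  forall (K : fieldType) (phi : {rmorphism F -> K}) (P : quad K),
    on_J (phi eps) (phi delta) P ->
    forall W Z : K,
      has_value (phi eps) (phi delta) (map_frac phi w) P W Z <->
      has_value (phi eps) (phi delta) (map_frac phi w) (jopp P) W Z.

Definition inverted_montgomery_like (F : fieldType) (eps delta : F)
    (w : frac F) (e : F) : Prop :=
  [/\ is_ratfun eps delta w, even_on_J eps delta w &
    forall P1 P2 : quad F, on_J eps delta P1 -> on_J eps delta P2 ->
    forall W0 Z0 W1 Z1 W2 Z2 W3 Z3 W4 Z4 : F,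
      has_value eps delta w (jadd eps delta P2 (jopp P1)) W0 Z0 ->
      has_value eps delta w P1 W1 Z1 ->
      has_value eps delta w P2 W2 Z2 ->
      has_value eps delta w (jadd eps delta P1 P2) W3 Z3 ->
      has_value eps delta w (jadd eps delta P1 P1) W4 Z4 ->
      W0 * Z0 != 0 ->
      peq2 W4 Z4 (4 * W1 * Z1 * ((W1 + Z1) ^+ 2 - e * W1 * Z1))
                 ((W1 ^+ 2 - Z1 ^+ 2) ^+ 2)
      /\ peq2 W3 Z3 (Z0 * (W1 * Z2 - W2 * Z1) ^+ 2)
                    (W0 * (W1 * W2 - Z1 * Z2) ^+ 2)].

(** [4 s x^2 y^2 / (1 - eps x^4)^2] with [x = X/Z] and [y = Y/Z], both terms
    multiplied by [Z^8]. *)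
Definition jw (K : fieldType) (eps s : K) : frac K :=
  Frac ((4 * s) *: (mX K ^+ 2 * mY K ^+ 2 * mZ K ^+ 4))
       ((mZ K ^+ 4 - eps *: mX K ^+ 4) ^+ 2).

(* Main.v *)
From mathcomp Require Import all_boot all_order all_algebra.
From mathcomp.multinomials Require Import mpoly.
From mathcomp Require Import ring.
Require Import Defs.

(** The function [u = s T / Z], that is [s x^2], on [J] satisfies
    [u(2P) = 4 u (u^2 + 2 (delta / s) u + 1) / (1 - u^2)^2] and
    [u(P1 + P2) u(P2 - P1) = (u1 - u2)^2 / (1 - u1 u2)^2], and
    [w = 4 s x^2 y^2 / (1 - s^2 x^4)^2] is [u] evaluated at [2P].  Doubling is an
    endomorphism, so [w] obeys the same two formulas; since
    [u^2 + 2 (delta / s) u + 1 = (u + 1)^2 - e u], these are the required ones.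

    In coordinates, [w] has at [P] the value [(wnum : wden)], two quartic forms
    in [(T, Z)] without a common zero on [J].  For doubling, the point [2P] has
    [(s T : Z) = (wnum : wden)], and both forms are composed once more
    ([w_double]).  For differential addition, [T : Z] at [P1 + P2] and
    [P2 - P1] is given, for each of the two expressions of the group law, by
    the squares of
      [A = X1 Y2 + X2 Y1], [B = X1 Y2 - X2 Y1],
      [C = T1 Z2 - T2 Z1], [D = Z1 Z2 - s^2 T1 T2].
    Here [A B = C D] on [J], and [A^2 + B^2] is a polynomial in the [T_i], [Z_i].
    Hence the products of [wnum] and of [wden] over the two points, being
    symmetric in [A^2], [B^2], are polynomials in [T_i], [Z_i]; they turn out to
    be a common multiple of the squares of [N1 M2 - N2 M1] and [M1 M2 - N1 N2]
    ([w_product], [w_diff_add]), where [(Ni : Mi)] is the value of [w] at [Pi].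

    What remains is to see that the value of [w] as a rational function is
    [(wnum : wden)] at every point ([has_value_jw]), including the points at
    infinity, where the given quotient is [0 / 0].  Dividing both terms by [Z^4]
    modulo the ideal of [J] gives a quotient whose terms never vanish together.
    That any other quotient for the same function agrees with it at a point with
    [Z = 0] requires cancelling [Z^4] there ([J_ideal_cancel_mZ4]). *)

Set Implicit Arguments.
Unset Strict Implicit.
Unset Printing Implicit Defensive.

Import GRing.Theory.
Local Open Scope ring_scope.

(** * Evaluating forms at points of the curve *)

Lemma meval_mX (K : fieldType) (P : quad K) : (mX K).@[qcoord P] = qX P.
Proof. by rewrite mevalXU. Qed.

Lemma meval_mY (K : fieldType) (P : quad K) : (mY K).@[qcoord P] = qY P.
Proof. by rewrite mevalXU. Qed.

Lemma meval_mT (K : fieldType) (P : quad K) : (mT K).@[qcoord P] = qT P.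
Proof. by rewrite mevalXU. Qed.

Lemma meval_mZ (K : fieldType) (P : quad K) : (mZ K).@[qcoord P] = qZ P.
Proof. by rewrite mevalXU. Qed.

Definition meval_coord := (meval_mX, meval_mY, meval_mT, meval_mZ).

Lemma mevalXn (n : nat) (K : fieldType) (v : 'I_n -> K) (k : nat) :
  {morph meval v : p / p ^+ k}.
Proof. by move=> p; rewrite rmorphXn. Qed.

(** Powers come first because the product rule also matches squares. *)
Definition meval_simp := (mevalXn, mevalB, mevalD, mevalM, mevalZ, meval_coord).

Lemma J_ideal_meval (K : fieldType) (eps delta : K) (p : {mpoly K[4]})
    (P : quad K) :
  J_ideal eps delta p -> on_J eps delta P -> p.@[qcoord P] = 0.
Proof.
move=> [a [b ->]] /and3P[_ /eqP hX /eqP hY].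
by rewrite !meval_simp; ring: hX hY.
Qed.

(** * Cancelling a power of Z at the points at infinity *)

Lemma horner_mmap_polyC (K : fieldType) (n : nat) (h : 'I_n -> {poly K})
    (p : {mpoly K[n]}) (c : K) :
  (mmap polyC h p).[c] = p.@[fun i => (h i).[c]].
Proof.
rewrite mevalE /mmap horner_sum; apply: eq_bigr => m _.
rewrite hornerM hornerC /mmap1 horner_prod; congr (_ * _).
by apply: eq_bigr => i _; rewrite horner_exp.
Qed.

(** Where [Z] is nonzero it is enough to evaluate.  A point with [Z = 0] is
    [(0 : Y : T : 0)], and [t |-> (T t : Y R(t) : T : T t^2)] passes through it at
    [t = 0], where [R] is the Taylor polynomial of degree 8 of
    [sqrt (1 + 2 (delta / eps) t^2 + t^4 / eps)].  The first equation of [J] holds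
    exactly on this arc and the second modulo [t^10], while [Z^4] becomes
    [T^4 t^8]; so [h] vanishes at [t = 0]. *)
Lemma J_ideal_cancel_mZ4 (K : fieldType) (eps delta : K) (h : {mpoly K[4]})
    (P : quad K) :
  (2 : K) != 0 -> eps != 0 -> on_J eps delta P ->
  J_ideal eps delta (mZ K ^+ 4 * h) -> h.@[qcoord P] = 0.
Proof.
move=> nz2 nze PJ hJ.
have [Z0|Zn] := eqVneq (qZ P) 0; last first.
  have /eqP := J_ideal_meval hJ PJ.
  by rewrite !meval_simp mulf_eq0 expf_eq0 (negPf Zn) /= => /eqP.
have TZ := on_J_TZ PJ; have Tn : qT P != 0 by apply/eqP => /TZ; apply.
move: PJ => /and3P[_ /eqP hX /eqP hY].
have X0 : qX P = 0 by apply/eqP; rewrite -sqrf_eq0 hX Z0 mulr0.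
rewrite X0 Z0 !expr0n /= mulr0 !addr0 in hY.
(* With these, the radicand is 1 + 2 p t^2 + (p^2 + 4 k) t^4. *)
pose p := delta / eps; pose k := (eps^-1 - p ^+ 2) / 4.
have nz4 : (4 : K) != 0 by rewrite (_ : 4 = 2 * 2) ?mulf_neq0 //; ring.
have hd : delta = eps * p by rewrite /p; field.
have h1 : eps * p ^+ 2 = 1 - 4 * eps * k by rewrite /k; field; rewrite nze nz4.
clearbody p k.
pose R : {poly K} := 1 + p%:P * 'X ^+ 2 + 2 * k%:P * 'X ^+ 4
  - 2 * p%:P * k%:P * 'X ^+ 6 + (2 * p%:P ^+ 2 * k%:P - 2 * k%:P ^+ 2) * 'X ^+ 8.
pose arc := qcoord (Quad ((qT P)%:P * 'X) ((qY P)%:P * R) (qT P)%:P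
                         ((qT P)%:P * 'X ^+ 2)).
have arcX : mmap polyC arc (mX K) = (qT P)%:P * 'X by rewrite mmapX mmap1U.
have arcY : mmap polyC arc (mY K) = (qY P)%:P * R by rewrite mmapX mmap1U.
have arcT : mmap polyC arc (mT K) = (qT P)%:P by rewrite mmapX mmap1U.
have arcZ : mmap polyC arc (mZ K) = (qT P)%:P * 'X ^+ 2.
  by rewrite mmapX mmap1U.
case: hJ => a [b /(congr1 (mmap polyC arc))].
rewrite !(rmorphM, rmorphB, rmorphD, rmorphXn) /=.
rewrite !mmapZ !rmorphXn /= arcX arcY arcT arcZ.
move: (mmap _ _ h) (horner_mmap_polyC arc h 0) => H Hh.
set a' := mmap _ _ a; set b' := mmap _ _ b.
have hYp : (qY P)%:P ^+ 2 = eps%:P * (qT P)%:P ^+ 2 :> {poly K}.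
  by rewrite -!rmorphXn -rmorphM /= hY.
have h1p : eps%:P * p%:P ^+ 2 = 1 - 4 * eps%:P * k%:P :> {poly K}.
  by rewrite -[4]polyC_natr -polyC1 -!rmorphXn -!rmorphM -rmorphB /= h1.
rewrite hd !rmorphM /= -[2%:P]/(2%:R%:P) polyC_natr => e.
(* R^2 = 1 + 2 p t^2 + (p^2 + 4 k) t^4 + t^10 rho. *)
pose rho : {poly K} := 2 * (p%:P * (2 * p%:P ^+ 2 * k%:P - 2 * k%:P ^+ 2)
    - 4 * p%:P * k%:P ^+ 2)
  + (4 * k%:P * (2 * p%:P ^+ 2 * k%:P - 2 * k%:P ^+ 2)
    + 4 * p%:P ^+ 2 * k%:P ^+ 2) * 'X ^+ 2
  - 4 * p%:P * k%:P * (2 * p%:P ^+ 2 * k%:P - 2 * k%:P ^+ 2) * 'X ^+ 4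
  + (2 * p%:P ^+ 2 * k%:P - 2 * k%:P ^+ 2) ^+ 2 * 'X ^+ 6.
have {e} : (qT P)%:P ^+ 4 * H
    = 'X ^+ 2 * (b' * (eps%:P * (qT P)%:P ^+ 2 * rho)).
  apply: (mulfI (expf_neq0 8 (negbT (polyX_eq0 K)))).
  transitivity (((qT P)%:P * 'X^2) ^+ 4 * H); first by ring.
  by rewrite e /R /rho; ring: hYp h1p.
move/(congr1 (fun q : {poly K} => q.[0])).
rewrite -rmorphXn !hornerM hornerX !mul0r hornerC Hh => /eqP.
rewrite mulf_eq0 expf_eq0 (negPf Tn) /= => /eqP <-; apply: meval_eq.
apply: ord4P; rewrite /arc /qcoord /tnth /= /R !hornerE /= ?X0 ?Z0; ring.
Qed.

(** * The value of w as a pair of binary forms *)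

Definition wnum (K : comNzRingType) (s delta T Z : K) : K :=
  4 * s * T * Z * (s ^+ 2 * T ^+ 2 + 2 * delta * T * Z + Z ^+ 2).

Definition wden (K : comNzRingType) (s T Z : K) : K :=
  (Z ^+ 2 - s ^+ 2 * T ^+ 2) ^+ 2.

Lemma wnum_scale (K : comNzRingType) (s delta c T Z : K) :
  wnum s delta (c * T) (c * Z) = c ^+ 4 * wnum s delta T Z.
Proof. by rewrite /wnum; ring. Qed.

Lemma wden_scale (K : comNzRingType) (s c T Z : K) :
  wden s (c * T) (c * Z) = c ^+ 4 * wden s T Z.
Proof. by rewrite /wden; ring. Qed.

(** If the second form vanishes then [Z = s T] or [Z = - s T], and there the first
    one is a nonzero multiple of [delta + s] or of [delta - s]. *)
Lemma wnum_wden_coprime (K : fieldType) (s delta T Z : K) :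
  (2 : K) != 0 -> s ^+ 2 * (delta ^+ 2 - s ^+ 2) != 0 ->
  (T != 0) || (Z != 0) -> (wnum s delta T Z != 0) || (wden s T Z != 0).
Proof.
move=> nz2; rewrite mulf_eq0 expf_eq0 /= subr_sqr mulf_eq0 !negb_or.
move=> /and3P[s0 dms dps] TZ.
have [|] := boolP (wden s T Z != 0); first by rewrite orbT.
rewrite negbK orbF sqrf_eq0 -exprMn subr_sqr mulf_eq0 subr_eq0 addr_eq0 => h.
have T0 : T != 0.
  apply: contraTneq TZ => T0; move: h; rewrite T0 mulr0 oppr0 orbb => ->.
  by rewrite eqxx.
have nz8 : (8 : K) != 0.
  by rewrite (_ : 8 = 2 * 2 * 2) ?mulf_neq0 //; ring.
case/orP: h => /eqP ->; rewrite /wnum.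
  rewrite (_ : _ * _ = 8 * s ^+ 3 * T ^+ 4 * (delta + s)); last by ring.
  by rewrite !mulf_neq0 ?expf_neq0.
rewrite (_ : _ * _ = 8 * s ^+ 3 * T ^+ 4 * (delta - s)); last by ring.
by rewrite !mulf_neq0 ?expf_neq0.
Qed.

(** The quotient defining [w] after substituting [X^2 = T Z] and dividing both
    terms by [Z^4]; on [J] it evaluates to [wnum] and [wden]. *)
Definition jw_reduced (K : fieldType) (s : K) : frac K :=
  Frac ((4 * s) *: (mT K * mZ K * mY K ^+ 2))
       ((mZ K ^+ 2 - s ^+ 2 *: mT K ^+ 2) ^+ 2).

Lemma jw_reducedE (K : fieldType) (s delta : K) (P : quad K) :
  on_J (s ^+ 2) delta P ->
  (fnum (jw_reduced s)).@[qcoord P] = wnum s delta (qT P) (qZ P) /\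
  (fden (jw_reduced s)).@[qcoord P] = wden s (qT P) (qZ P).
Proof.
move=> /and3P[_ /eqP hX /eqP hY]; rewrite /wnum /wden /= !meval_simp.
by split=> //; ring: hX hY.
Qed.

Lemma TZ_nonzero (K : fieldType) (eps delta : K) (P : quad K) :
  on_J eps delta P -> (qT P != 0) || (qZ P != 0).
Proof.
by move=> PJ; rewrite -negb_and; apply/andP => -[/eqP + /eqP]; apply: on_J_TZ PJ.
Qed.

Lemma jopp_on_J (K : fieldType) (eps delta : K) (P : quad K) :
  on_J eps delta P -> on_J eps delta (jopp P).
Proof. by rewrite /on_J /qnonzero /= sqrrN oppr_eq0. Qed.

Lemma jzero_on_J (K : fieldType) (eps delta : K) : on_J eps delta (jzero K).
Proof.
by rewrite /on_J /qnonzero /= oner_eq0 !expr0n /= mul0r !mulr0 !add0r expr1n !eqxx.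
Qed.

Lemma dhomog_coord (K : fieldType) :
  [/\ mX K \is 1.-homog, mY K \is 1.-homog, mT K \is 1.-homog
    & mZ K \is 1.-homog].
Proof. by split; rewrite dhomogX /= mdeg1. Qed.

Lemma jw_ratfun (K : fieldType) (s delta : K) :
  is_ratfun (s ^+ 2) delta (jw (s ^+ 2) s).
Proof.
have [hX hY hT hZ] := dhomog_coord K.
split.
  exists 8; split=> /=.
    apply: dhomogZ; apply: (dhomogM (d := 4) (e := 4)); last exact: (dhomogMn 4 hZ).
    by apply: (dhomogM (d := 2) (e := 2)); [exact: (dhomogMn 2 hX) | exact: (dhomogMn 2 hY)].
  apply: (dhomogMn (d := 4) 2); apply: rpredB; first exact: (dhomogMn 4 hZ).
  by apply: dhomogZ; exact: (dhomogMn 4 hX).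
move=> /J_ideal_meval /(_ (jzero_on_J _ _)) /eqP; rewrite !meval_simp /=.
by rewrite !expr0n /= mulr0 subr0 !expr1n oner_eq0.
Qed.

Lemma jw_reduced_ratfun (K : fieldType) (s delta : K) :
  is_ratfun (s ^+ 2) delta (jw_reduced s).
Proof.
have [hX hY hT hZ] := dhomog_coord K.
split.
  exists 4; split=> /=.
    apply: dhomogZ; apply: (dhomogM (d := 2) (e := 2)); last exact: (dhomogMn 2 hY).
    exact: (dhomogM (d := 1) (e := 1)).
  apply: (dhomogMn (d := 2) 2); apply: rpredB; first exact: (dhomogMn 2 hZ).
  by apply: dhomogZ; exact: (dhomogMn 2 hT).
move=> /J_ideal_meval /(_ (jzero_on_J _ _)) /eqP; rewrite !meval_simp /=.
by rewrite !expr0n /= mulr0 subr0 !expr1n oner_eq0.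
Qed.

Lemma jw_reduced_cofactor (K : fieldType) (s : K) :
  exists a b : {mpoly K[4]},
    fnum (jw (s ^+ 2) s)
      = mZ K ^+ 4 * fnum (jw_reduced s) + a * (mX K ^+ 2 - mT K * mZ K) /\
    fden (jw (s ^+ 2) s)
      = mZ K ^+ 4 * fden (jw_reduced s) + b * (mX K ^+ 2 - mT K * mZ K).
Proof.
pose E : {mpoly K[4]} := (s ^+ 2)%:MP.
(* Z^4 - E X^4 is Z^2 (Z^2 - E T^2) - v (X^2 - T Z). *)
pose v := E * (mX K ^+ 2 + mT K * mZ K).
exists ((4 * s)%:MP * mY K ^+ 2 * mZ K ^+ 4).
exists (v * (v * (mX K ^+ 2 - mT K * mZ K)
             - 2 * mZ K ^+ 2 * (mZ K ^+ 2 - E * mT K ^+ 2))).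
by rewrite /v /E /= -!mul_mpolyC; split; ring.
Qed.

Lemma jw_same_reduced (K : fieldType) (s delta : K) :
  same_ratfun (s ^+ 2) delta (jw (s ^+ 2) s) (jw_reduced s).
Proof.
rewrite /same_ratfun; have [a [b [-> ->]]] := jw_reduced_cofactor s.
exists (a * fden (jw_reduced s) - b * fnum (jw_reduced s)), 0.
by ring.
Qed.

(** For any quotient [g] representing [w], the relation between [g] and
    [jw_reduced] holds in the ideal after multiplication by [Z^4], hence at [P] by
    cancellation.  If [wden] vanished at [P], so would [wnum], as the denominator
    of [g] does not. *)
Lemma regular_at_jw (K : fieldType) (s delta : K) (P : quad K) (v : K) :
  (2 : K) != 0 -> s ^+ 2 * (delta ^+ 2 - s ^+ 2) != 0 ->
  on_J (s ^+ 2) delta P ->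
  regular_at (s ^+ 2) delta (jw (s ^+ 2) s) P v <->
  wden s (qT P) (qZ P) != 0
    /\ v = wnum s delta (qT P) (qZ P) / wden s (qT P) (qZ P).
Proof.
move=> nz2 nzd PJ; have [hN hM] := jw_reducedE PJ; split; last first.
  move=> [M0 ->]; exists (jw_reduced s); rewrite hN hM.
  by split=> //; [exact: jw_reduced_ratfun | exact: jw_same_reduced].
move=> [g [_ [a [b hab]] g0 ->]].
have e2 : s ^+ 2 != 0 by apply: contraNneq nzd => ->; rewrite mul0r.
have [c [d [hc hd]]] := jw_reduced_cofactor s.
rewrite hc hd in hab.
have /(J_ideal_cancel_mZ4 nz2 e2 PJ) : J_ideal (s ^+ 2) delta (mZ K ^+ 4 *
    (fnum (jw_reduced s) * fden g - fnum g * fden (jw_reduced s))).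
  exists (a - c * fden g + d * fnum g), b.
  transitivity ((mZ K ^+ 4 * fnum (jw_reduced s) + c * (mX K ^+ 2 - mT K * mZ K))
      * fden g - fnum g * (mZ K ^+ 4 * fden (jw_reduced s)
      + d * (mX K ^+ 2 - mT K * mZ K))
    - (c * fden g - d * fnum g) * (mX K ^+ 2 - mT K * mZ K)); first by ring.
  by rewrite hab; ring.
rewrite mevalB (mevalM _ _ (fden g)) (mevalM _ (fnum g)) hN hM => /eqP; rewrite subr_eq0 => /eqP h.
have M0 : wden s (qT P) (qZ P) != 0.
  apply/eqP => M0.
  have := @wnum_wden_coprime _ s delta (qT P) (qZ P) nz2 nzd.
  rewrite M0 eqxx orbF.
  move: h; rewrite M0 mulr0 => /eqP; rewrite mulf_eq0 (negPf g0) orbF => ->.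
  by move=> /(_ (TZ_nonzero PJ)).
by split=> //; apply/eqP; rewrite eqr_div // h mulrC.
Qed.

Lemma has_value_jw (K : fieldType) (s delta : K) (P : quad K) (W Z : K) :
  (2 : K) != 0 -> s ^+ 2 * (delta ^+ 2 - s ^+ 2) != 0 ->
  on_J (s ^+ 2) delta P ->
  has_value (s ^+ 2) delta (jw (s ^+ 2) s) P W Z <->
  peq2 W Z (wnum s delta (qT P) (qZ P)) (wden s (qT P) (qZ P)).
Proof.
move=> nz2 nzd PJ; have rE v := regular_at_jw v nz2 nzd PJ.
have := wnum_wden_coprime nz2 nzd (TZ_nonzero PJ).
set N := wnum _ _ _ _ in rE *; set M := wden _ _ _ in rE * => NM.
have [M0|M0] := eqVneq M 0.
  have N0 : N != 0 by move: NM; rewrite M0 eqxx orbF.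
  have nreg : ~ exists v, regular_at (s ^+ 2) delta (jw (s ^+ 2) s) P v.
    by case=> v /rE[]; rewrite M0 eqxx.
  split=> [[[v [r _]]|[_ [h _ e]]]|[h _ e]]; first by case: nreg; exists v.
    by split; rewrite ?N0 // M0; move: e; rewrite !mulr0 mul1r => <-; rewrite mulr0.
  right; split=> //; split; rewrite ?oner_eq0 // mulr0 mul1r.
  move/eqP: e; rewrite M0 mulr0 eq_sym mulf_eq0 (negPf N0) /= => /eqP.
  by move=> ->.
split=> [[[v [/rE[_ ->] [h _ e]]]|[nreg _]]|[h _ e]].
- by split=> //; rewrite -(mulr1 W) e -!mulrA [_^-1 * _]mulrC -mulrA divff ?mulr1 // [Z * _]mulrC.
- by case: nreg; exists (N / M); apply/rE.
left; exists (N / M); split; first by apply/rE.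
by split; rewrite ?oner_eq0 ?orbT // mulr1 mulrAC -e mulfK.
Qed.

(** * Scaling in the projective line *)

Lemma peq2_proportional (K : fieldType) (W Z N M : K) :
  peq2 W Z N M -> exists c, [/\ c != 0, W = c * N & Z = c * M].
Proof.
move=> [WZ NM e]; have [M0|M0] := eqVneq M 0.
  have N0 : N != 0 by move: NM; rewrite M0 eqxx orbF.
  move/eqP: e; rewrite M0 mulr0 eq_sym mulf_eq0 (negPf N0) /= => /eqP Z0.
  have W0 : W != 0 by move: WZ; rewrite Z0 eqxx orbF.
  by exists (W / N); rewrite mulf_neq0 ?invr_neq0 // divfK // Z0 mulr0.
have eW : W = Z / M * N by rewrite mulrAC [Z * N]mulrC -e mulfK.
exists (Z / M); split=> //; last by rewrite divfK.
rewrite mulf_neq0 ?invr_neq0 //; apply: contraTneq WZ => Z0.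
by rewrite eW Z0 !mul0r eqxx.
Qed.

(** * Evenness *)

(** The value depends on [T] and [Z] only, and negation changes only [X]. *)
Lemma jw_even (K : fieldType) (s delta : K) :
  (2 : K) != 0 -> s ^+ 2 * (delta ^+ 2 - s ^+ 2) != 0 ->
  even_on_J (s ^+ 2) delta (jw (s ^+ 2) s).
Proof.
move=> nz2 nzd L phi P.
have nz2' : (2 : L) != 0 by rewrite -(rmorph_nat phi 2) fmorph_eq0.
have nzd' : phi s ^+ 2 * (phi delta ^+ 2 - phi s ^+ 2) != 0.
  by rewrite -!rmorphXn -rmorphB -rmorphM fmorph_eq0.
have -> : map_frac phi (jw (s ^+ 2) s) = jw (phi s ^+ 2) (phi s).
  rewrite /map_frac /jw /= !map_mpolyZ !rmorphXn rmorphB !rmorphM /=.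
  by rewrite map_mpolyZ !rmorphXn /= !map_mpolyX rmorph_nat.
rewrite rmorphXn => PJ W Z.
have NJ := jopp_on_J PJ.
split=> /has_value_jw h; apply/has_value_jw => //; exact: h.
Qed.

(** * Doubling and differential addition *)

(** With [S = A^2 + B^2] and [A B = C D], consider the points given by
    [T : Z = A^2 : D^2] and [B^2 : D^2].  Their [wnum]s have the first left-hand
    side times [D^8] as product, their [wden]s the square of the second one times
    [D^8].  In the first, the long factor is [(Y3 Y0 / D^2)^2] for [Y3] and [Y0]
    the [Y]-coordinates of the two points. *)
Lemma w_cross_factor (K : comNzRingType) (s delta T1 Z1 T2 Z2 : K) :
  let y1 := s ^+ 2 * T1 ^+ 2 + 2 * delta * T1 * Z1 + Z1 ^+ 2 in
  let y2 := s ^+ 2 * T2 ^+ 2 + 2 * delta * T2 * Z2 + Z2 ^+ 2 in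
  let S := 2 * (T1 * Z1 * y2 + T2 * Z2 * y1) in
  let C := T1 * Z2 - T2 * Z1 in
  let D := Z1 * Z2 - s ^+ 2 * T1 * T2 in
  let N1 := wnum s delta T1 Z1 in let M1 := wden s T1 Z1 in
  let N2 := wnum s delta T2 Z2 in let M2 := wden s T2 Z2 in
  16 * s ^+ 2 * C ^+ 2 * D ^+ 2 *
    (s ^+ 4 * C ^+ 4 + 2 * s ^+ 2 * delta * C ^+ 2 * S
     + s ^+ 2 * (S ^+ 2 - 2 * C ^+ 2 * D ^+ 2)
     + 4 * delta ^+ 2 * C ^+ 2 * D ^+ 2 + 2 * delta * D ^+ 2 * S + D ^+ 4)
    = (N1 * M2 - N2 * M1) ^+ 2
  /\ D ^+ 4 - s ^+ 2 * (S ^+ 2 - 2 * C ^+ 2 * D ^+ 2) + s ^+ 4 * C ^+ 4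
    = M1 * M2 - N1 * N2.
Proof. by rewrite /wnum /wden; split; ring. Qed.

(** [a], [b], [c], [d] stand for [A^2], [B^2], [C^2], [D^2].  The first two
    equations describe [P1 + P2], [P2 - P1] through the first expression of the
    group law, the last two through the second.  The products are symmetric in
    [a] and [b], so that the hypotheses determine them. *)
Lemma w_product (K : comNzRingType) (s delta a b c d T1 Z1 T2 Z2 : K) :
  let y1 := s ^+ 2 * T1 ^+ 2 + 2 * delta * T1 * Z1 + Z1 ^+ 2 in
  let y2 := s ^+ 2 * T2 ^+ 2 + 2 * delta * T2 * Z2 + Z2 ^+ 2 in
  a * b = c * d -> a + b = 2 * (T1 * Z1 * y2 + T2 * Z2 * y1) ->
  c = (T1 * Z2 - T2 * Z1) ^+ 2 -> d = (Z1 * Z2 - s ^+ 2 * T1 * T2) ^+ 2 ->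
  let N1 := wnum s delta T1 Z1 in let M1 := wden s T1 Z1 in
  let N2 := wnum s delta T2 Z2 in let M2 := wden s T2 Z2 in
  [/\ wnum s delta a d * wnum s delta b d = d ^+ 4 * (N1 * M2 - N2 * M1) ^+ 2,
      wden s a d * wden s b d = d ^+ 4 * (M1 * M2 - N1 * N2) ^+ 2,
      wnum s delta c b * wnum s delta c a = c ^+ 4 * (N1 * M2 - N2 * M1) ^+ 2
    & wden s c b * wden s c a = c ^+ 4 * (M1 * M2 - N1 * N2) ^+ 2].
Proof.
move=> y1 y2 hab hS hc hd N1 M1 N2 M2.
have [<- <-] := w_cross_factor s delta T1 Z1 T2 Z2.
rewrite -/y1 -/y2 -hS.
set C := T1 * Z2 - _ in hc *; set D := Z1 * Z2 - _ in hd *.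
rewrite {}hc {}hd /wnum /wden in hab *; clearbody C D; clear -hab.
by split; ring: hab.
Qed.

Lemma jadd_TZ_cases (K : fieldType) (eps delta X1 Y1 T1 Z1 X2 Y2 T2 Z2 : K) :
  let R := jadd eps delta (Quad X1 Y1 T1 Z1) (Quad X2 Y2 T2 Z2) in
  qT R = (X1 * Y2 + X2 * Y1) ^+ 2 /\ qZ R = (Z1 * Z2 - eps * T1 * T2) ^+ 2 \/
  qT R = (T1 * Z2 - T2 * Z1) ^+ 2 /\ qZ R = (X1 * Y2 - X2 * Y1) ^+ 2.
Proof. by rewrite /jadd; case: ifP => _; [left | right]. Qed.

(** The doubled point has [(s T : Z) = (wnum : wden)], exactly and not only up to
    a factor because [jlaw1] is defined at every pair [(P, P)]; the
    right-hand sides are the two forms at that point. *)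
Lemma w_double (K : fieldType) (s delta : K) (P : quad K) :
  (2 : K) != 0 -> s ^+ 2 * (delta ^+ 2 - s ^+ 2) != 0 ->
  on_J (s ^+ 2) delta P ->
  let N := wnum s delta (qT P) (qZ P) in let M := wden s (qT P) (qZ P) in
  let R := jadd (s ^+ 2) delta P P in
  wnum s delta (qT R) (qZ R)
    = 4 * N * M * ((N + M) ^+ 2 - 2 * (s - delta) / s * N * M) /\
  wden s (qT R) (qZ R) = (N ^+ 2 - M ^+ 2) ^+ 2.
Proof.
move=> nz2 nzd PJ N M R; have TZ := on_J_TZ (jadd_on_J nz2 nzd PJ PJ).
have s0 : s != 0 by apply: contraNneq nzd => ->; rewrite expr0n /= mul0r.
have [eT eZ] : s * qT R = N /\ qZ R = M.
  move: PJ @N @M @R TZ; case: P => X Y T Z /and3P[_ /eqP hX /eqP hY] N M R.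
  rewrite /= in hX hY; rewrite hX in hY.
  case: (jadd_TZ_cases (s ^+ 2) delta X Y T Z X Y T Z) => [[hT hZ] _|[hT hZ] []].
  - by rewrite /R hT hZ /N /M /wnum /wden /=; split; ring: hX hY.
  - by rewrite hT; ring.
  by rewrite hZ; ring.
by rewrite -eZ -eT /wnum /wden; split; [field | ring].
Qed.

(** The sum and the difference may come from different expressions of the group
    law.  Since [A^2 B^2 = C^2 D^2], the pairs [(A^2, D^2)] and [(C^2, B^2)] are
    proportional, and so are [(B^2, D^2)] and [(C^2, A^2)], which reduces the
    mixed cases to [w_product].  The factors that must be nonzero are coordinates
    [T] or [Z] of the difference, which both divide [wnum] there. *)
Lemma w_diff_add (K : fieldType) (s delta : K) (P1 P2 : quad K) :
  on_J (s ^+ 2) delta P1 -> on_J (s ^+ 2) delta P2 ->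
  let N1 := wnum s delta (qT P1) (qZ P1) in let M1 := wden s (qT P1) (qZ P1) in
  let N2 := wnum s delta (qT P2) (qZ P2) in let M2 := wden s (qT P2) (qZ P2) in
  let S := jadd (s ^+ 2) delta P1 P2 in
  let D := jadd (s ^+ 2) delta P2 (jopp P1) in
  wnum s delta (qT D) (qZ D) != 0 ->
  exists2 k, k != 0 &
    wnum s delta (qT S) (qZ S) * wnum s delta (qT D) (qZ D)
      = k * (N1 * M2 - N2 * M1) ^+ 2 /\
    wden s (qT S) (qZ S) * wden s (qT D) (qZ D) = k * (M1 * M2 - N1 * N2) ^+ 2.
Proof.
case: P1 P2 => [X1 Y1 T1 Z1] [X2 Y2 T2 Z2].
move=> /and3P[_ /eqP hX1 /eqP hY1] /and3P[_ /eqP hX2 /eqP hY2].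
rewrite /= in hX1 hY1 hX2 hY2; rewrite hX1 in hY1; rewrite hX2 in hY2.
move=> N1 M1 N2 M2 S D ND.
pose a := (X1 * Y2 + X2 * Y1) ^+ 2; pose b := (X1 * Y2 - X2 * Y1) ^+ 2.
pose c := (T1 * Z2 - T2 * Z1) ^+ 2; pose d := (Z1 * Z2 - s ^+ 2 * T1 * T2) ^+ 2.
have hab : a * b = c * d by rewrite /a /b /c /d; ring: hX1 hY1 hX2 hY2.
have [NS1 MS1 NS2 MS2] : [/\ wnum s delta a d * wnum s delta b d = d ^+ 4 * (N1 * M2 - N2 * M1) ^+ 2,
      wden s a d * wden s b d = d ^+ 4 * (M1 * M2 - N1 * N2) ^+ 2,
      wnum s delta c b * wnum s delta c a = c ^+ 4 * (N1 * M2 - N2 * M1) ^+ 2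
    & wden s c b * wden s c a = c ^+ 4 * (M1 * M2 - N1 * N2) ^+ 2].
  by apply: w_product => //; rewrite /a /b /=; ring: hX1 hY1 hX2 hY2.
have hS : qT S = a /\ qZ S = d \/ qT S = c /\ qZ S = b by exact: jadd_TZ_cases.
have hD : qT D = b /\ qZ D = d \/ qT D = c /\ qZ D = a.
  rewrite /D /jopp /= /a /b /c /d.
  case: (jadd_TZ_cases (s ^+ 2) delta X2 Y2 T2 Z2 (- X1) Y1 T1 Z1) => -[-> ->].
    by left; split; ring.
  by right; split; ring.
clearbody S D a b c d.
have [TD ZD] : qT D != 0 /\ qZ D != 0.
  by split; apply: contraNneq ND => ->; rewrite /wnum !(mulr0, mul0r).
case: hS hD => -[eTS eZS] [] [eTD eZD]; rewrite eTS eZS eTD eZD in ND TD ZD *.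
- by exists (d ^+ 4); rewrite ?expf_neq0.
- have eca : c * a = a * c by exact: mulrC.
  have ecd : c * d = a * b by [].
  exists (a ^+ 4); rewrite ?expf_neq0 //.
  split; apply: (mulfI (expf_neq0 4 TD)); rewrite mulrA.
    by rewrite -wnum_scale eca ecd wnum_scale -mulrA NS2 mulrCA.
  by rewrite -wden_scale eca ecd wden_scale -mulrA MS2 mulrCA.
- have edb : d * b = b * d by exact: mulrC.
  have edc : d * c = b * a by rewrite mulrC -hab mulrC.
  exists (b ^+ 4); rewrite ?expf_neq0 //.
  split; apply: (mulfI (expf_neq0 4 ZD)); rewrite mulrA.
    by rewrite -wnum_scale edb edc wnum_scale -mulrA NS1 mulrCA.
  by rewrite -wden_scale edb edc wden_scale -mulrA MS1 mulrCA.
- by exists (c ^+ 4); rewrite ?expf_neq0.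
Qed.

(** Valid over every field of characteristic other than 2.  If both terms of the
    formula for [P1 + P2] vanished, so would [wnum] and [wden] at [P1 + P2]. *)
Theorem jw_inverted_montgomery_like (K : fieldType) (s delta : K) :
  (2 : K) != 0 -> s ^+ 2 * (delta ^+ 2 - s ^+ 2) != 0 ->
  inverted_montgomery_like (s ^+ 2) delta (jw (s ^+ 2) s) (2 * (s - delta) / s).
Proof.
move=> nz2 nzd; split; [exact: jw_ratfun | exact: jw_even |].
move=> P1 P2 P1J P2J W0 Z0 W1 Z1 W2 Z2 W3 Z3 W4 Z4.
have J0 := jadd_on_J nz2 nzd P2J (jopp_on_J P1J).
have J3 := jadd_on_J nz2 nzd P1J P2J.
have J4 := jadd_on_J nz2 nzd P1J P1J.
move=> /(has_value_jw _ _ nz2 nzd J0) v0 /(has_value_jw _ _ nz2 nzd P1J) v1.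
move=> /(has_value_jw _ _ nz2 nzd P2J) v2 /(has_value_jw _ _ nz2 nzd J3) v3.
move=> /(has_value_jw _ _ nz2 nzd J4) v4.
have [N4 M4] := w_double nz2 nzd P1J.
have := w_diff_add P1J P2J.
move: v0 v1 v2 v3 v4 N4 M4 => /=.
move: (wnum_wden_coprime nz2 nzd (TZ_nonzero J3)) (wnum_wden_coprime nz2 nzd (TZ_nonzero J4)).
set N3 := wnum _ _ (qT (jadd _ _ P1 P2)) _; set M3 := wden _ (qT (jadd _ _ P1 P2)) _.
set N4 := wnum _ _ (qT (jadd _ _ P1 P1)) _; set M4 := wden _ (qT (jadd _ _ P1 P1)) _.
set N0 := wnum _ _ (qT (jadd _ _ P2 _)) _; set M0 := wden _ (qT (jadd _ _ P2 _)) _.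
set N1 := wnum _ _ _ _; set M1 := wden _ _ _; set N2 := wnum _ _ _ _; set M2 := wden _ _ _.
move=> NM3 NM4 /peq2_proportional[c0 [c0n -> ->]] /peq2_proportional[c1 [c1n -> ->]].
move=> /peq2_proportional[c2 [c2n -> ->]] /peq2_proportional[c3 [c3n -> ->]].
move=> /peq2_proportional[c4 [c4n -> ->]] eN4 eM4 sumE.
clearbody N0 M0 N1 M1 N2 M2 N3 M3 N4 M4.
rewrite !mulf_eq0 !negb_or (negPf c0n) /= => /andP[N0n M0n].
have [k kn [eN eM]] := sumE N0n.
have nz (c x y : K) : c != 0 -> (x != 0) || (y != 0) -> (c * x != 0) || (c * y != 0).
  by move=> cn; rewrite !mulf_eq0 (negPf cn).
set e := _ / _ in eN4 *.
split.
  have -> : 4 * (c1 * N1) * (c1 * M1) * ((c1 * N1 + c1 * M1) ^+ 2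
      - e * (c1 * N1) * (c1 * M1)) = c1 ^+ 4 * N4 by rewrite eN4; ring.
  have -> : ((c1 * N1) ^+ 2 - (c1 * M1) ^+ 2) ^+ 2 = c1 ^+ 4 * M4.
    by rewrite eM4; ring.
  split; [exact: nz | by apply: nz; rewrite ?expf_neq0 | by ring].
have -> : c0 * M0 * (c1 * N1 * (c2 * M2) - c2 * N2 * (c1 * M1)) ^+ 2
  = c0 * (c1 * c2) ^+ 2 * (M0 * (N1 * M2 - N2 * M1) ^+ 2) by ring.
have -> : c0 * N0 * (c1 * N1 * (c2 * N2) - c1 * M1 * (c2 * M2)) ^+ 2
  = c0 * (c1 * c2) ^+ 2 * (N0 * (M1 * M2 - N1 * N2) ^+ 2) by ring.
split; [exact: nz | apply: nz | ].
- by rewrite !mulf_neq0 // expf_neq0 // mulf_neq0.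
- have : (N3 * N0 != 0) || (M3 * M0 != 0).
    by rewrite !mulf_eq0 (negPf M0n) (negPf N0n) !orbF.
  rewrite eN eM; move: (_ ^+ 2) (_ ^+ 2) => L2 K2.
  by rewrite !mulf_eq0 (negPf kn) (negPf M0n) (negPf N0n).
apply: (mulfI kn).
transitivity (c3 * c0 * (c1 * c2) ^+ 2 * N3 * N0 * (k * (M1 * M2 - N1 * N2) ^+ 2)); first by ring.
rewrite -eM; transitivity (c0 * (c1 * c2) ^+ 2 * c3 * M3 * M0 * (N3 * N0)); first by ring.
by rewrite eN; ring.
Qed.

Theorem proposition10 (F : finFieldType) (eps delta s : F)
    (hF : 2%N \notin [pchar F])
    (hJ : eps * (delta ^+ 2 - eps) != 0)
    (hchi : quad_char eps = 1)
    (hs : s ^+ 2 = eps) :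
  inverted_montgomery_like eps delta (jw eps s) (2 * (s - delta) / s).
Proof.
by subst eps; apply: jw_inverted_montgomery_like.
Qed.
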